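(* Let $\mathcal{S}=\{\Sigma_s\}_{s=0}^{S-1}\subset\mathbb{C}^{L\times L}$ be a linearly independent set (over $\mathbb{R}$) of Hermitian Toeplitz matrices, let $\mathcal{K}\subset\{0,\ldots,L-1\}$, let $\sigma_s\in\mathbb{C}^L$ be the correlation vector (first column) of $\Sigma_s$ for each $s$, and let $\tilde\sigma_s$ be the vector whose entries are the elements of $\sigma_s$ indexed by $\Delta(\mathcal{K})$. Then $\mathcal{K}$ defines an $\mathcal{S}$-covariance sampler if and only if $\mathrm{rank}\,R=S$, where $$R=\begin{bmatrix}\tilde\sigma_0&\tilde\sigma_1&\cdots&\tilde\sigma_{S-1}\\ \tilde\sigma_0^{*}&\tilde\sigma_1^{*}&\cdots&\tilde\sigma_{S-1}^{*}\end{bmatrix}$$ and $^*$ denotes entrywise complex conjugation.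
   Context: Vector and matrix entries are indexed starting from $0$. The difference set of $\mathcal{A}\subset\mathbb{Z}$ is $\Delta(\mathcal{A})=\{\delta\ge 0:\ \exists a_1,a_2\in\mathcal{A}\text{ such that }\delta=a_2-a_1\}$. Covariance samplers: given a linearly independent set (over $\mathbb{R}$) $\mathcal{S}$ of $L\times L$ Hermitian Toeplitz matrices, a matrix $\bar\Phi\in\mathbb{C}^{K\times L}$ defines an $\mathcal{S}$-covariance sampler if the map $\phi:\mathrm{span}_{\mathbb{R}}\,\mathcal{S}\to\mathrm{span}_{\mathbb{R}}\{\bar\Phi\Sigma_s\bar\Phi^H:\Sigma_s\in\mathcal{S}\}$, $\phi(\Sigma)=\bar\Phi\Sigma\bar\Phi^H$, is invertible. A set $\mathcal{K}\subset\{0,\ldots,L-1\}$ is said to define an $\mathcal{S}$-covariance sampler if the (sparse) matrix $\bar\Phi\in\mathbb{C}^{|\mathcal{K}|\times L}$ formed by the rows of the identity matrix $I_L$ with indices in $\mathcal{K}$ (in increasing order) defines an $\mathcal{S}$-covariance sampler. *)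

(* Defs.v *)
From mathcomp Require Import all_boot all_order all_algebra.
From mathcomp Require Import boolp classical_sets functions reals.
From mathcomp Require Import complex.

Set Implicit Arguments.
Unset Strict Implicit.
Unset Printing Implicit Defensive.

Import Order.TTheory GRing.Theory Num.Theory.
Local Open Scope ring_scope.
Local Open Scope classical_set_scope.
Local Open Scope complex_scope.
Local Open Scope sesquilinear_scope.

(* Matrices over R[i] are canonically a module over R[i] only, so real linear
   combinations are written with coefficients embedded by %:C. *)

Definition real_free (R : realType) (m n S : nat)
    (A : 'I_S -> 'M[R[i]]_(m, n)) : Prop :=
  forall c : 'I_S -> R, \sum_s (c s)%:C *: A s = 0 -> forall s, c s = 0.

Definition real_span (R : realType) (m n S : nat)
    (A : 'I_S -> 'M[R[i]]_(m, n)) : set 'M[R[i]]_(m, n) :=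
  [set B | exists c : 'I_S -> R, B = \sum_s (c s)%:C *: A s].

Definition toeplitz (T : Type) (n : nat) (A : 'M[T]_n) : Prop :=
  forall i j k l : 'I_n, i%:Z - j%:Z = k%:Z - l%:Z -> A i j = A k l.

Definition sample_cov (R : realType) (k n : nat) (Phi : 'M[R[i]]_(k, n))
    (A : 'M[R[i]]_n) : 'M[R[i]]_k :=
  Phi *m A *m Phi ^t*.

Definition covariance_sampler (R : realType) (k n S : nat)
    (Sigma : 'I_S -> 'M[R[i]]_n) (Phi : 'M[R[i]]_(k, n)) : Prop :=
  set_bij (real_span Sigma) (real_span (fun s => sample_cov Phi (Sigma s)))
          (sample_cov Phi).

(* enum_val lists a subset of 'I_n in increasing order. *)
Definition rows_in (T : Type) (m n : nat) (D : {set 'I_m}) (A : 'M[T]_(m, n)) :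
    'M[T]_(#|D|, n) :=
  rowsub (@enum_val _ (mem D)) A.

Definition set_covariance_sampler (R : realType) (n S : nat)
    (Sigma : 'I_S -> 'M[R[i]]_n) (K : {set 'I_n}) : Prop :=
  covariance_sampler Sigma (rows_in K 1%:M).

(* Subtraction is in int, where d%:Z is nonnegative; nonnegative differences of
   elements of 'I_n are smaller than n, so none is lost by taking d in 'I_n. *)
Definition difference_set (n : nat) (K : {set 'I_n}) : {set 'I_n} :=
  [set d : 'I_n | [exists a1 in K, exists a2 in K, d%:Z == a2%:Z - a1%:Z]]%SET.

(* First column; the index 0 : 'I_n exists because i does. *)
Definition correlation_vector (T : Type) (n : nat) (A : 'M[T]_n) : 'cV[T]_n :=
  \col_i A i (Ordinal (leq_ltn_trans (leq0n i) (ltn_ord i))).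

Definition columns_mx (T : Type) (m S : nat) (v : 'I_S -> 'cV[T]_m) :
    'M[T]_(m, S) :=
  \matrix_(i, s) v s i ord0.

(* Main.v *)
(* The sampled matrix of A consists of the entries A a b with a, b in K. For A
   Hermitian Toeplitz these are, up to conjugation, the entries of its first
   column indexed by the difference set of K; so the sampling map is injective
   on the real span iff the vectors tsigma are linearly independent over R.
   Stacking the conjugates turns real independence into complex independence. *)

Require Import Defs.
From mathcomp Require Import all_boot all_order all_algebra.
From mathcomp Require Import boolp classical_sets functions reals.
From mathcomp Require Import complex.

Import Order.TTheory GRing.Theory Num.Theory.
Local Open Scope ring_scope.
Local Open Scope complex_scope.

Lemma conj_real_complex (R : rcfType) (x : R) : Num.conj (x%:C) = x%:C.
Proof. exact: conjc_real. Qed.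

Lemma sample_cov_sum (R : realType) (k n S : nat) (Phi : 'M[R[i]]_(k, n))
    (c : 'I_S -> R[i]) (A : 'I_S -> 'M[R[i]]_n) :
  sample_cov Phi (\sum_s c s *: A s) = \sum_s c s *: sample_cov Phi (A s).
Proof.
rewrite /sample_cov mulmx_sumr mulmx_suml; apply: eq_bigr => s _.
by rewrite -scalemxAr -scalemxAl.
Qed.

(** By linearity the image of the real span is exactly the target span, so only injectivity is at
    stake. Freeness of [Sigma] turns a trivial kernel into trivial coefficients. *)
Lemma covariance_samplerP (R : realType) (k n S : nat)
    (Sigma : 'I_S -> 'M[R[i]]_n) (Phi : 'M[R[i]]_(k, n)) :
  real_free Sigma ->
  covariance_sampler Sigma Phi <->
  real_free (fun s => sample_cov Phi (Sigma s)).
Proof.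
move=> Sigma_free; split=> [[_ inj _] c c0 | free].
- apply: Sigma_free; apply: inj.
  + by rewrite inE; exists c.
  + rewrite inE; exists (fun=> 0).
    by rewrite big1 // => s _; rewrite scale0r.
  + by rewrite sample_cov_sum c0 /sample_cov mulmx0 mul0mx.
- split.
  + by move=> _ [c ->]; exists c; rewrite sample_cov_sum.
  + move=> A B; rewrite !inE => -[a ->] [b ->].
    (* Equal samples give a vanishing combination with coefficients [a s - b s]. *)
    rewrite !sample_cov_sum => /eqP; rewrite -subr_eq0 -sumrB => /eqP eq_ab.
    apply: eq_bigr => s _; congr (_%:C *: _); apply/eqP; rewrite -subr_eq0.
    apply/eqP/(free (fun s => a s - b s)).
    by rewrite -[RHS]eq_ab; apply: eq_bigr => t _; rewrite raddfB scalerBl.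
  + move=> _ [c ->]; exists (\sum_s (c s)%:C *: Sigma s); first by exists c.
    by rewrite sample_cov_sum.
Qed.

Lemma toeplitz_sum (F : fieldType) (n S : nat) (c : 'I_S -> F)
    (A : 'I_S -> 'M[F]_n) :
  (forall s, toeplitz (A s)) -> toeplitz (\sum_s c s *: A s).
Proof.
move=> toepA i j k l eq_ij_kl; rewrite !summxE; apply: eq_bigr => s _.
by rewrite !mxE (toepA s i j k l).
Qed.

Lemma hermsymmxE (C : numClosedFieldType) (n : nat) (A : 'M[C]_n) :
  A \is hermsymmx -> forall i j, A i j = Num.conj (A j i).
Proof.
by move=> /is_hermitianmxP hA i j; rewrite {1}hA expr0 scale1r !mxE.
Qed.

(** Conjugate transposition fixes each [A s] and, the coefficients being real, each scalar as
    well. *)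
Lemma hermsymmx_real_sum (R : realType) (n S : nat) (c : 'I_S -> R)
    (A : 'I_S -> 'M[R[i]]_n) :
  (forall s, A s \is hermsymmx) -> \sum_s (c s)%:C *: A s \is hermsymmx.
Proof.
move=> hA; apply/is_hermitianmxP; rewrite expr0 scale1r.
apply/matrixP=> i j; rewrite !mxE !summxE rmorph_sum; apply: eq_bigr => s _.
by rewrite !mxE rmorphM /= conj_real_complex -hermsymmxE.
Qed.

Lemma sample_cov_rows_in (R : realType) (n : nat) (K : {set 'I_n})
    (A : 'M[R[i]]_n) :
  sample_cov (rows_in K 1%:M) A =
  mxsub (@enum_val _ (mem K)) (@enum_val _ (mem K)) A.
Proof.
apply/matrixP=> i j; rewrite /sample_cov /rows_in mul_rowsub_mx mul1mx !mxE.
rewrite (bigD1 (enum_val j)) //= big1 => [|k neq_kj].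
  by rewrite !mxE eqxx conjC1 mulr1 addr0.
by rewrite !mxE eq_sym (negPf neq_kj) conjC0 mulr0.
Qed.

Lemma sample_cov_eq0P (R : realType) (n : nat) (K : {set 'I_n})
    (A : 'M[R[i]]_n) :
  A \is hermsymmx -> toeplitz A ->
  sample_cov (rows_in K 1%:M) A = 0 <->
  rows_in (difference_set K) (correlation_vector A) = 0.
Proof.
move=> hA tA; rewrite sample_cov_rows_in; split=> /matrixP A0.
- apply/matrixP=> i j; rewrite !mxE.
  have := enum_valP i; rewrite inE.
  move=> /exists_inP[a1 Ka1 /exists_inP[a2 Ka2 /eqP d_eq]].
  (* The sampled entry at [(a2, a1)] lies on the same diagonal as the entry [(d, 0)] of the first
     column. *)
  have := A0 (enum_rank_in Ka2 a2) (enum_rank_in Ka1 a1).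
  rewrite !mxE !enum_rankK_in // => <-; apply: tA.
  by rewrite subr0.
- have A_ge a1 a2 : a1 \in K -> a2 \in K -> (a1 <= a2)%N -> A a2 a1 = 0.
    move=> Ka1 Ka2 le12.
    (* The truncated subtraction is exact because of [le12]. *)
    pose d := Ordinal (leq_ltn_trans (leq_subr a1 a2) (ltn_ord a2)).
    have d_eq : d%:Z = a2%:Z - a1%:Z by rewrite /= subzn.
    have Dd : d \in difference_set K.
      rewrite inE; apply/exists_inP; exists a1 => //.
      by apply/exists_inP; exists a2 => //; apply/eqP.
    have := A0 (enum_rank_in Dd d) ord0.
    rewrite !mxE !enum_rankK_in // => <-; apply: tA.
    by rewrite subr0 d_eq.
  apply/matrixP=> i j; rewrite !mxE.
  have [le_ji | /ltnW le_ij] := leqP (enum_val j) (enum_val i).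
    by rewrite A_ge ?enum_valP.
  (* Entries above the diagonal are conjugates of entries below it. *)
  by rewrite hermsymmxE // A_ge ?enum_valP // conjC0.
Qed.

Lemma rows_in_correlation_vector_sum (F : fieldType) (n S : nat)
    (D : {set 'I_n}) (c : 'I_S -> F) (A : 'I_S -> 'M[F]_n) :
  rows_in D (correlation_vector (\sum_s c s *: A s)) =
  \sum_s c s *: rows_in D (correlation_vector (A s)).
Proof.
apply/matrixP=> i j; rewrite !mxE !summxE; apply: eq_bigr => s _.
by rewrite !mxE.
Qed.

Lemma mul_columns_mx (F : fieldType) (m S : nat) (v : 'I_S -> 'cV[F]_m)
    (u : 'cV[F]_S) : columns_mx v *m u = \sum_s u s ord0 *: v s.
Proof.
apply/colP=> i; rewrite mxE summxE; apply: eq_bigr => s _.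
by rewrite !mxE mulrC.
Qed.

Lemma map_conj_sum (C : numClosedFieldType) (m n S : nat) (c : 'I_S -> C)
    (A : 'I_S -> 'M[C]_(m, n)) :
  map_mx Num.conj (\sum_s c s *: A s) =
  \sum_s Num.conj (c s) *: map_mx Num.conj (A s).
Proof. by rewrite raddf_sum; apply: eq_bigr => s _; exact: map_mxZ. Qed.

(** Transposing reduces this to the injectivity of right multiplication by a row-free matrix. *)
Lemma rank_eq_colsP (F : fieldType) (m n : nat) (A : 'M[F]_(m, n)) :
  \rank A = n <-> (forall u : 'cV_n, A *m u = 0 -> u = 0).
Proof.
rewrite -mxrank_tr; split=> [rkA u Au0 | A_inj].
- have /row_free_inj freeA : row_free A^T by rewrite /row_free rkA.
  apply: trmx_inj; apply: freeA.
  by rewrite -trmx_mul Au0 !trmx0 mul0mx.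
- apply/eqP/inj_row_free => v vA0; apply: trmx_inj; rewrite trmx0.
  by apply: A_inj; apply: trmx_inj; rewrite trmx_mul trmxK vA0 trmx0.
Qed.

(* If the complex vector u is in the kernel of the stacked matrix, then u and
   its conjugate both annihilate the family v, hence so do the real vectors
   Re u and Im u. *)
Lemma rank_conj_stackP (R : realType) (m S : nat) (v : 'I_S -> 'cV[R[i]]_m) :
  \rank (col_mx (columns_mx v) (columns_mx (fun s => map_mx Num.conj (v s))))
    = S <-> real_free v.
Proof.
rewrite rank_eq_colsP; split=> [inj c c0 s | free u].
- have : \col_s (c s)%:C = 0 :> 'cV[R[i]]_S.
    apply: inj; rewrite mul_col_mx !mul_columns_mx.
    have -> : \sum_s (\col_s (c s)%:C) s ord0 *: v s = 0.
      by rewrite -[RHS]c0; apply: eq_bigr => t _; rewrite mxE.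
    rewrite -[RHS]col_mx0; congr col_mx.
    (* Real coefficients are fixed by conjugation, so the lower block is the conjugate of the
       relation [c0]. *)
    have := congr1 (map_mx Num.conj) c0; rewrite map_conj_sum map_mx0.
    by apply: etrans; apply: eq_bigr => t _; rewrite mxE conj_real_complex.
  by move=> /colP/(_ s); rewrite !mxE => /complexI.
- rewrite mul_col_mx -col_mx0 => /eq_col_mx[]; rewrite !mul_columns_mx => vu0.
  (* Conjugating the lower block moves the conjugation from the vectors [v s] to the coefficients
     [u]. *)
  move=> /(congr1 (map_mx Num.conj)); rewrite map_conj_sum map_mx0.
  have conjK (w : 'cV[R[i]]_m) : map_mx Num.conj (map_mx Num.conj w) = w.
    by apply/matrixP=> i j; rewrite !mxE conjCK.
  under eq_bigr do rewrite conjK.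
  move=> vuJ0.
  have Re0 : forall s, complex.Re (u s ord0) = 0.
    apply: free; under eq_bigr do rewrite ReJ_add mulrC -scalerA scalerDl.
    by rewrite -scaler_sumr big_split /= vu0 vuJ0 addr0 scaler0.
  have Im0 : forall s, complex.Im (u s ord0) = 0.
    apply: free.
    under eq_bigr do rewrite ImJ_sub -mulrA mulrC -scalerA scalerBl.
    by rewrite -scaler_sumr sumrB vu0 vuJ0 subr0 scaler0.
  by apply/colP=> s; rewrite mxE [LHS]complexE Re0 Im0 mulr0 addr0.
Qed.

Theorem theorem1 (R : realType) (L S : nat) (Sigma : 'I_S -> 'M[R[i]]_L)
    (Sigma_herm : forall s, Sigma s \is hermsymmx)
    (Sigma_toeplitz : forall s, toeplitz (Sigma s))
    (Sigma_free : real_free Sigma)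
    (K : {set 'I_L}) :
  let sigma s := correlation_vector (Sigma s) in
  let tsigma s := rows_in (difference_set K) (sigma s) in
  let Rmx := col_mx (columns_mx tsigma)
                    (columns_mx (fun s => map_mx Num.conj (tsigma s))) in
  set_covariance_sampler Sigma K <-> \rank Rmx = S.
Proof.
move=> sigma tsigma Rmx.
rewrite rank_conj_stackP /set_covariance_sampler covariance_samplerP //.
(* Both combinations come from the single matrix [\sum_s (c s)%:C *: Sigma s], which is again
   Hermitian Toeplitz, so the two notions of freeness have the same relations. *)
have vanish (c : 'I_S -> R) :
    \sum_s (c s)%:C *: sample_cov (rows_in K 1%:M) (Sigma s) = 0 <->
    \sum_s (c s)%:C *: tsigma s = 0.
  rewrite -sample_cov_sum -rows_in_correlation_vector_sum.
  by apply: sample_cov_eq0P; [exact: hermsymmx_real_sum | exact: toeplitz_sum].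
by split=> free c /vanish; exact: free.
Qed.
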